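(* Let $0<p<1$. For each $N\ge1$ let $H_N(\sigma)$, $\sigma\in\{+1,-1\}^N$, be i.i.d. Binomial random variables with parameters $N$ and $p$ (all $N$ on one probability space), and let $Z_N(\beta)=\sum_{\sigma\in\{+1,-1\}^N}e^{-\beta H_N(\sigma)}$ for $\beta\ge0$. (a) If $p\le\frac12$, then almost surely, for $\beta\ge0$, $$\lim_{N\to\infty}\frac1N\log Z_N(\beta)=\log2-\beta+\log\left(p+(1-p)e^\beta\right).$$ (b) If $p>\frac12$, let $x_1\in(0,p)$ be the solution of $x\log\frac xp+(1-x)\log\frac{1-x}{1-p}=\log2$ and let $\beta_0>0$ be determined by $\frac{p}{p+(1-p)e^{\beta_0}}=x_1$. Then almost surely $$\lim_{N\to\infty}\frac1N\log Z_N(\beta)=\begin{cases}\log2-\beta+\log\left(p+(1-p)e^\beta\right)&\text{for }0\le\beta\le\beta_0,\\-\beta x_1&\text{for }\beta>\beta_0.\end{cases}$$ *)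

(* Defs.v *)
From HB Require Import structures.
From mathcomp Require Import all_boot all_order all_algebra.
From mathcomp Require Import all_classical all_reals all_analysis.

Set Implicit Arguments.
Unset Strict Implicit.
Unset Printing Implicit Defensive.

Import Order.TTheory GRing.Theory Num.Theory.
Import numFieldNormedType.Exports.

Local Open Scope classical_set_scope.
Local Open Scope ring_scope.

(* {+1,-1}^N, with true standing for +1 and false for -1. *)
Definition config (N : nat) := {ffun 'I_N -> bool}.

Definition mutually_independent d d' (T : measurableType d)
    (T' : measurableType d') (R : realType) (P : probability T R)
    (I : finType) (X : I -> {RV P >-> T'}) : Prop :=
  forall (J : {set I}) (A : I -> set T'),
    (forall i, i \in J -> measurable (A i)) ->
    P (\bigcap_(i in [set` J]) (X i @^-1` A i)) =
      (\prod_(i in J) P (X i @^-1` A i))%E.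

(* Since every subset of nat is measurable, equality of laws is tested on all
   of them. *)
Definition iid_binomial d (T : measurableType d) (R : realType)
    (P : probability T R) (n : nat) (p : R)
    (I : finType) (X : I -> {RV P >-> nat}) : Prop :=
  mutually_independent X /\
  forall i (U : set nat), distribution P (X i) U = binomial_prob n p U.

Definition partition_function d (T : measurableType d) (R : realType)
    (P : probability T R) (N : nat) (H : config N -> {RV P >-> nat})
    (beta : R) (omega : T) : R :=
  \sum_(sigma : config N) expR (- beta * (H sigma omega)%:R).

Definition annealed_free_energy (R : realType) (p beta : R) : R :=
  ln 2 - beta + ln (p + (1 - p) * expR beta).

Definition relative_entropy (R : realType) (p x : R) : R :=
  x * ln (x / p) + (1 - x) * ln ((1 - x) / (1 - p)).

(* Main.v *)
Require Import Defs.
From HB Require Import structures.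
From mathcomp Require Import all_boot all_order all_algebra.
From mathcomp Require Import all_classical all_reals all_analysis.
From mathcomp Require Import measurable_realfun ring lra.

Set Implicit Arguments.
Unset Strict Implicit.
Unset Printing Implicit Defensive.

Import Order.TTheory GRing.Theory Num.Theory.
Import numFieldNormedType.Exports.

Local Open Scope classical_set_scope.
Local Open Scope ring_scope.

(** Write [f] for [annealed_free_energy p], so that the expectation of [Z_N(b)]
is [expR (N * f b)], and [q b] for the mean of one trial after its law is
tilted by [expR (- b * x)]; [q b = - f' b].  The configurations that carry
[Z_N(b)] in expectation are those with [H_N] close to [q b * N], and their
expected number is about [expR (N * g b)] with [g b = f b + b * q b], which is
[ln 2] minus the relative entropy of [q b].  So everything is decided by the
sign of [g]: it is strictly decreasing from [g 0 = ln 2] because [f] is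
strictly convex ([annealed_tangent], [tilted_entropy_anti]), it stays positive
if [p <= 1/2], and it has one zero [b0] if [p > 1/2].  As [q] is a decreasing
bijection from the positive reals to the interval from [0] to [p], the zero of
[g] and the solution [x1 = q b0] of the entropy equation determine each other.

Upper bound.  By Markov and Borel-Cantelli, [Z_N(b) < expR (N * (f b + e))]
eventually ([ae_partition_upper]).  For [b >= b0], superadditivity of the power
with exponent [b / b0] gives [Z_N(b) <= Z_N(b0) ^ (b / b0)], and
[f b0 = - b0 * q b0] turns the bound at [b0] into [- b * q b0].

Lower bound.  If [g b > 0], the part of [Z_N(b)] carried by the configurations
with [H_N] within [e * N] of [q b * N] is a sum of independent terms.  Its
expectation is almost all of [expR (N * f b)] ([window_mass], a Chernoff bound),
and the truncation makes its relative variance of order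
[expR (- N * (f b + b * (q b - e)))], which is summable for small [e].  Hence it
is eventually at least half its expectation ([ae_partition_lower]).  On this
window [H_N <= (q b + e) * N]; therefore the same event bounds [Z_N(b')] for every
[b' >= b]: in the limit the free energy lies above the tangent of [f] at [b].
Letting [b] increase to the inverse temperature of interest, or to [b0] beyond
the transition, gives the matching lower bound.

The tangent bounds hold for all [b'] at once and [Z_N] is monotone in [b], so
the almost sure statements are needed for rational parameters only, and one
null set serves all inverse temperatures. *)

(** * The annealed free energy and its tangents *)

(** Laplace transform of one Bernoulli trial: factoring out [expR (- beta)] from
the annealed free energy makes the limit of large [beta] harmless. *)
Definition trial_laplace (R : realType) (p beta : R) : R :=
  p * expR (- beta) + (1 - p).

Definition tilted_mean (R : realType) (p beta : R) : R :=
  p / (p + (1 - p) * expR beta).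

(** Exponential growth rate of the expected number of configurations that dominate
the annealed partition function, see [relative_entropy_tilted]. *)
Definition tilted_entropy (R : realType) (p beta : R) : R :=
  annealed_free_energy p beta + beta * tilted_mean p beta.

Section FreeEnergy.
Context {R : realType} {p : R}.
Hypotheses (p_gt0 : 0 < p) (p_lt1 : p < 1).

Local Notation f := (annealed_free_energy p).
Local Notation D := (trial_laplace p).
Local Notation q := (tilted_mean p).
Local Notation g := (tilted_entropy p).

Lemma trial_laplace_gt0 b : 0 < D b.
Proof. by rewrite addr_gt0 ?mulr_gt0 ?expR_gt0 ?subr_gt0. Qed.

Lemma trial_laplaceE b : D b = (p + (1 - p) * expR b) * expR (- b).
Proof. by rewrite mulrDl -mulrA -expRD subrr expR0 mulr1. Qed.

Lemma tilted_den_gt0 b : 0 < p + (1 - p) * expR b.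
Proof. by rewrite addr_gt0 ?mulr_gt0 ?expR_gt0 ?subr_gt0. Qed.

Lemma annealed_free_energyE b : f b = ln 2 + ln (D b).
Proof.
rewrite trial_laplaceE lnM ?posrE ?expR_gt0 ?tilted_den_gt0// expRK.
by rewrite /annealed_free_energy; ring.
Qed.

Lemma expR_annealed b : expR (f b) = 2 * D b.
Proof. by rewrite annealed_free_energyE expRD !lnK// posrE ?trial_laplace_gt0. Qed.

Lemma tilted_meanE b : q b = p * expR (- b) / D b.
Proof.
rewrite /tilted_mean trial_laplaceE -mulf_div divff ?mulr1// gt_eqF ?expR_gt0//.
Qed.

Lemma tilted_mean_gt0 b : 0 < q b.
Proof. by rewrite divr_gt0 ?tilted_den_gt0. Qed.

Lemma tilted_mean_lt1 b : q b < 1.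
Proof.
by rewrite ltr_pdivrMr ?tilted_den_gt0// mul1r ltrDl mulr_gt0 ?expR_gt0 ?subr_gt0.
Qed.

Lemma tilted_mean_anti a b : a < b -> q b < q a.
Proof.
move=> ab; rewrite /tilted_mean ltr_pM2l// ltf_pV2 ?posrE ?tilted_den_gt0//.
by rewrite ltrD2l ltr_pM2l ?subr_gt0// ltr_expR.
Qed.

Lemma tilted_mean_inj : injective q.
Proof.
move=> a b ab; case: (ltgtP a b) => // /tilted_mean_anti; rewrite ab ltxx //.
Qed.

Lemma tilted_mean_le_expR a b : a <= b -> q a <= expR (b - a) * q b.
Proof.
move=> ab; rewrite /tilted_mean mulrCA ler_pM2l// ler_pdivlMr ?tilted_den_gt0//.
rewrite mulrC ler_pdivrMr ?tilted_den_gt0// mulrDr mulrCA -expRD subrK lerD2r.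
by rewrite ler_peMl ?(ltW p_gt0)// -expR0 ler_expR subr_ge0.
Qed.

(** Tilting by [b] and then by [t] is tilting by [b + t]: the ratio of the two
Laplace transforms is that of a trial with success probability [q b]. *)
Lemma trial_laplaceD b t : D (b + t) = D b * (q b * expR (- t) + (1 - q b)).
Proof.
have Db := trial_laplace_gt0 b.
have -> : D (b + t) = p * expR (- b) * expR (- t) + (D b - p * expR (- b)).
  by rewrite /trial_laplace opprD expRD; ring.
by rewrite tilted_meanE; field; rewrite gt_eqF.
Qed.

(** Strict convexity of [f], with [- q b] as its derivative.  After the common
factor is removed this is the weighted arithmetic-geometric inequality for
[expR (- u)] and [1], which follows from [1 + x < expR x] at two points. *)
Lemma annealed_tangent b s : s != b -> f b - q b * (s - b) < f s.
Proof.
move=> sb; have Db := trial_laplace_gt0 b.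
have q0 := tilted_mean_gt0 b; have q1 := tilted_mean_lt1 b.
have [u def_s] : exists u, s = b + u by exists (s - b); ring.
have u0 : u != 0 by apply: contra_neq sb => u0; rewrite def_s u0 addr0.
rewrite {}def_s {sb} (_ : b + u - b = u); last by ring.
rewrite !annealed_free_energyE trial_laplaceD.
have m0 : 0 < q b * expR (- u) + (1 - q b).
  by rewrite addr_gt0 ?(mulr_gt0 q0) ?expR_gt0 ?subr_gt0.
rewrite lnM ?posrE// addrA.
rewrite ltrD2l -ltr_expR lnK ?posrE//.
have -> : q b * expR (- u) + (1 - q b) =
  expR (- (q b * u)) * (q b * expR (- ((1 - q b) * u)) + (1 - q b) * expR (q b * u)).
  rewrite mulrDr mulrCA -expRD [expR _ * (_ * _)]mulrCA -expRD addNr expR0 mulr1.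
  by congr (_ * expR _ + _); ring.
rewrite ltr_pMr ?expR_gt0//.
have h1 : 1 + - ((1 - q b) * u) < expR (- ((1 - q b) * u)).
  by apply: expR_gt1Dx; rewrite oppr_eq0 mulf_neq0// subr_eq0 gt_eqF.
have h2 : 1 + q b * u < expR (q b * u).
  by apply: expR_gt1Dx; rewrite mulf_neq0// gt_eqF.
have h1' : q b * (1 - (1 - q b) * u) < q b * expR (- ((1 - q b) * u)).
  by rewrite ltr_pM2l.
have h2' : (1 - q b) * (1 + q b * u) < (1 - q b) * expR (q b * u).
  by rewrite ltr_pM2l ?subr_gt0.
by apply: le_lt_trans (ltrD h1' h2'); rewrite [leRHS](_ : _ = 1)//; ring.
Qed.

(** The slope of [f] is between [-1] and [0]. *)
Lemma annealed_lipschitz a b : a <= b -> f a <= f b + (b - a).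
Proof.
rewrite le_eqVlt => /predU1P[->|ab]; first by rewrite subrr addr0.
have := annealed_tangent (negbT (gt_eqF ab)).
have : q a * (b - a) <= 1 * (b - a).
  by rewrite ler_wpM2r ?subr_ge0 ?ltW// tilted_mean_lt1.
lra.
Qed.

(** [g b] is the value at [0] of the tangent of [f] at [b], and these values
decrease with the point of tangency because [f] is convex. *)
Lemma tilted_entropy_anti a b : 0 <= a -> a < b -> g b < g a.
Proof.
move=> a0 ab; have := annealed_tangent (negbT (lt_eqF ab)).
have := tilted_mean_anti ab => qq.
have : a * q b <= a * q a by rewrite ler_wpM2l// ltW.
rewrite /tilted_entropy; lra.
Qed.

Lemma tilted_entropy0 : g 0 = ln 2.
Proof.
rewrite /tilted_entropy mul0r addr0 annealed_free_energyE /trial_laplace.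
by rewrite oppr0 expR0 mulr1 [p + _]addrC subrK ln1 addr0.
Qed.

(** Already [f b > 0], since [expR (f b) = 2 * D b] exceeds [2 * (1 - p) >= 1]. *)
Lemma tilted_entropy_gt0 b : p <= 1 / 2 -> 0 <= b -> 0 < g b.
Proof.
move=> p12 b0; apply: ltr_wpDr; first by rewrite mulr_ge0// ltW ?tilted_mean_gt0.
rewrite -expR_gt1 expR_annealed /trial_laplace.
have := mulr_gt0 p_gt0 (expR_gt0 (- b)); lra.
Qed.

Lemma continuous_tilted_entropy : continuous g.
Proof.
move=> x; rewrite /tilted_entropy.
under eq_fun do rewrite annealed_free_energyE.
have ce (c : R) : {for x, continuous (fun y => c * expR y)}.
  by apply: cvgM; [exact: cvg_cst|exact: continuous_expR].
have cN (c : R) : {for x, continuous (fun y => c * expR (- y))}.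
  apply: cvgM; first exact: cvg_cst.
  by apply: continuous_comp; [exact: continuousN|exact: continuous_expR].
have cD : {for x, continuous D} by apply: cvgD; [exact: cN|exact: cvg_cst].
apply: cvgD.
  apply: cvgD; first exact: cvg_cst.
  exact: (@continuous_comp R R R D (@ln R) x cD (continuous_ln (trial_laplace_gt0 x))).
apply: cvgM; first exact: cvg_id.
apply: cvgM; first exact: cvg_cst.
apply: cvgV; first by rewrite gt_eqF ?tilted_den_gt0.
by apply: cvgD; [exact: cvg_cst|exact: ce].
Qed.

(** Both ratios in the relative entropy are explicit: [q b / p] is
[expR (- b) / D b] and [(1 - q b) / (1 - p)] is [1 / D b]. *)
Lemma relative_entropy_tilted b : relative_entropy p (q b) = ln 2 - g b.
Proof.
have Db := trial_laplace_gt0 b.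
rewrite /relative_entropy /tilted_entropy annealed_free_energyE.
have -> : q b / p = expR (- b) / D b.
  by rewrite tilted_meanE; field; rewrite !gt_eqF.
have -> : (1 - q b) / (1 - p) = (D b)^-1.
  have -> : 1 - p = D b - p * expR (- b) by rewrite /trial_laplace; ring.
  rewrite tilted_meanE; field; rewrite gt_eqF//= gt_eqF//.
  by rewrite /trial_laplace addrC addKr subr_gt0.
rewrite lnM ?posrE ?invr_gt0 ?expR_gt0// expRK lnV ?posrE//; ring.
Qed.

Lemma tilted_mean_surj x : 0 < x -> x < p -> exists2 b, 0 < b & q b = x.
Proof.
move=> x0 xp; have p10 : 0 < 1 - p by rewrite subr_gt0.
have x10 : 0 < 1 - x by rewrite subr_gt0 (lt_trans xp).
pose r := p * (1 - x) / (x * (1 - p)).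
(* the odds of the untilted trial divided by the odds of mean [x] *)
exists (ln r).
  apply: ln_gt0; rewrite ltr_pdivlMr ?mulr_gt0// mul1r !mulrBr !mulr1.
  by rewrite [p * x]mulrC ltrD2r.
rewrite /tilted_mean lnK ?posrE ?divr_gt0 ?mulr_gt0// /r.
have -> : p + (1 - p) * (p * (1 - x) / (x * (1 - p))) = p / x.
  by field; rewrite !gt_eqF.
by field; rewrite !gt_eqF.
Qed.

Lemma tilted_mean_lt_p b : 0 < b -> q b < p.
Proof.
move=> b0; rewrite ltr_pdivrMr ?tilted_den_gt0// ltr_pMr//.
rewrite -subr_gt0 (_ : _ - 1 = (1 - p) * (expR b - 1)); last by ring.
by rewrite mulr_gt0 ?subr_gt0 ?expR_gt1.
Qed.

(** [g] tends to [ln (2 * (1 - p)) < 0] at infinity; the point [B] makes this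
quantitative, and the intermediate value theorem applies. *)
Lemma tilted_entropy_zero : 1 / 2 < p -> exists2 b, 0 < b & g b = 0.
Proof.
move=> p12.
have p10 : 0 < 1 - p by rewrite subr_gt0.
pose c := - ln (2 * (1 - p)); pose K := p / (1 - p).
have c0 : 0 < c by rewrite oppr_gt0 ln_lt0//; apply/andP; split; lra.
have K0 : 0 < K by rewrite divr_gt0.
pose B := 4 * K / c.
have B0 : 0 < B by rewrite divr_gt0 // mulr_gt0 ?ltr0n.
have gB : g B <= 0.
  (* [f] and [B * q] exceed their limits [- c] and [0] by at most
     [expR (- B) * K] and [B * expR (- B) * K]. *)
  have eB : (1 + B) * expR (- B) * K <= c.
    have h : 1 + B / 2 <= expR (B / 2) by exact: expR_ge1Dx.
    have h2 : 0 < 1 + B / 2 by lra.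
    have h3 : expR (- (B / 2)) <= (1 + B / 2)^-1.
      by rewrite expRN lef_pV2 ?posrE ?expR_gt0.
    have -> : - B = - (B / 2) - B / 2 by field.
    rewrite expRD.
    have h4 : (1 + B) * expR (- (B / 2)) <= 2.
      apply: (@le_trans _ _ (2 * (1 + B / 2) * (1 + B / 2)^-1)).
        apply: ler_pM; rewrite ?expR_ge0//; lra.
      by rewrite mulfK// gt_eqF.
    rewrite mulrA; apply: (@le_trans _ _ (2 * (1 + B / 2)^-1 * K)).
      by rewrite ler_pM2r// ler_pM// ?expR_ge0// mulr_ge0 ?expR_ge0//; lra.
    rewrite mulrAC ler_pdivrMr// mulrDr mulr1 /B.
    have -> : c * (4 * K / c / 2) = 2 * K by field; rewrite gt_eqF.
    lra.
  have lnD : ln 2 + ln (D B) <= - c + expR (- B) * K.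
    have -> : D B = (1 - p) * (1 + expR (- B) * K).
      by rewrite /trial_laplace /K; field; rewrite gt_eqF.
    have eK : 0 < expR (- B) * K by rewrite mulr_gt0 ?expR_gt0.
    rewrite lnM ?posrE//; last by lra.
    rewrite addrA -lnM ?posrE// /c opprK lerD2l; apply: le_ln1Dx; lra.
  have qB : q B <= expR (- B) * K.
    rewrite tilted_meanE /K mulrCA mulrA ler_pM2l ?mulr_gt0 ?expR_gt0//.
    rewrite lef_pV2 ?posrE ?trial_laplace_gt0// /trial_laplace lerDr.
    by rewrite mulr_ge0 ?expR_ge0 ?ltW.
  rewrite /tilted_entropy annealed_free_energyE.
  have : B * q B <= B * (expR (- B) * K) by rewrite ler_pM2l.
  move: eB; rewrite mulrDl mulrDl mul1r -mulrA; lra.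
have [||b] := @IVT _ g 0 B 0 (ltW B0).
- exact/continuous_subspaceT/continuous_tilted_entropy.
- by rewrite tilted_entropy0 ge_min le_max gB (ltW (ln_gt0 _)) ?orbT// ltr1n.
rewrite in_itv/= => /andP[b0 _] gb; exists b => //.
rewrite lt_def b0 andbT; apply/eqP => b00; move: gb.
by rewrite b00 tilted_entropy0; apply/eqP; rewrite gt_eqF// ln_gt0// ltr1n.
Qed.

End FreeEnergy.

(** * Almost sure bounds from summable expectations *)

Lemma geometric_nneseries_lty (R : realType) (C r : R) :
  0 <= C -> 0 < r -> r < 1 -> (\sum_(n <oo) (C * r ^+ n)%:E < +oo)%E.
Proof.
move=> C0 r0 r1; apply: (@le_lt_trans _ _ (C / (1 - r))%:E); last exact: ltry.
apply: lime_le.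
  by apply: is_cvg_nneseries => n _ _; rewrite lee_fin mulr_ge0 ?exprn_ge0 ?(ltW r0).
apply: nearW => n /=; rewrite sumEFin lee_fin.
by apply: (@geometric_le_lim _ n C r); rewrite // gtr0_norm.
Qed.

(** Markov's inequality and the first Borel-Cantelli lemma in one step; both
halves of the proof of the free energy limit use it. *)
Lemma ae_eventually_lt1 (R : realType) (d : measure_display)
    (T : measurableType d) (P : probability T R) (X : nat -> T -> R) (C r : R) :
  (forall n, measurable_fun setT (X n)) -> (forall n x, 0 <= X n x) ->
  0 < r -> r < 1 ->
  (\forall n \near \oo, (\int[P]_x (X n x)%:E <= (C * r ^+ n)%:E)%E) ->
  {ae P, forall x, \forall n \near \oo, X n x < 1}.
Proof.
move=> mX X0 r0 r1 [n0 _ hn0].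
pose F n := [set x | 1 <= X (n + n0)%N x].
have mF n : measurable (F n).
  rewrite [F n](_ : _ = X (n + n0)%N @^-1` `[1, +oo[).
    by rewrite -[X in measurable X]setTI; exact: mX.
  by apply/seteqP; split => x /=; rewrite in_itv/= andbT.
have PF n : (P (F n) <= (`|C| * r ^+ n0 * r ^+ n)%:E)%E.
  apply: (@le_trans _ _ (C * r ^+ (n + n0))%:E); last first.
    rewrite lee_fin exprD -mulrA [r ^+ n0 * _]mulrC.
    by rewrite ler_wpM2r ?mulr_ge0 ?exprn_ge0 ?(ltW r0)// ler_norm.
  apply: le_trans (hn0 (n + n0)%N (leq_addl _ _)).
  rewrite -[X in P X]setIT -integral_indic//; apply: ge0_le_integral => //.
  - exact/measurable_EFinP/measurable_indic.
  - exact/measurable_EFinP.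
  - move=> x _; rewrite lee_fin indicE; case: (boolP (x \in F n)) => /=.
      by rewrite inE.
    by move=> _; exact: X0.
have F0 : P (lim_sup_set F) = 0%E.
  apply: lim_sup_set_cvg0 => //.
  have C0 : 0 <= `|C| * r ^+ n0 by rewrite mulr_ge0// exprn_ge0// ltW.
  apply: le_lt_trans (geometric_nneseries_lty C0 r0 r1).
  by apply: lee_nneseries => n _ //; exact: PF.
exists (lim_sup_set F); split => //.
  by apply: bigcap_measurable => // k _; exact: bigcup_measurable.
move=> x /=; apply: contra_notP => /existsNP[k /not_implyP[_ kF]].
exists (k + n0)%N => //= m km; rewrite ltNge; apply/negP => Xm; apply: kF.
have n0m : (n0 <= m)%N := leq_trans (leq_addl _ _) km.
by exists (m - n0)%N; rewrite /F /= ?subnK// leq_subRL// addnC.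
Qed.

(** * First and second moments of i.i.d. binomial sums *)

Definition binomial_mean (R : realType) (n : nat) (p : R) (w : nat -> R) : R :=
  \sum_(k < n.+1) binomial_pmf n p k * w k.

Section IidBinomial.
Context {R : realType} {d : measure_display} {T : measurableType d}.
Context {P : probability T R}.
Variables (n : nat) (p : R) (I : finType) (X : I -> {RV P >-> nat}).
Hypotheses (p_gt0 : 0 < p) (p_lt1 : p < 1) (iidX : iid_binomial n p X).

Lemma integral_binomial_rv i (w : nat -> R) : (forall k, 0 <= w k) ->
  (\int[P]_x (w (X i x))%:E = (binomial_mean n p w)%:E)%E.
Proof.
move=> w0; have [_ lawX] := iidX.
have p1' : (NngNum (ltW p_gt0))%:num <= 1 by rewrite /= ltW.
rewrite -(@ge0_integral_distribution _ _ _ _ _ P (X i) (EFin \o w))//.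
rewrite (@eq_measure_integral _ _ _ _ (binomial_prob n p)); last first.
  by move=> A _ _; exact: lawX.
rewrite (@integral_binomial _ n p (ltW p_gt0) p1')//.
by rewrite /binomial_mean -sumEFin; apply: eq_bigr.
Qed.

Lemma measurable_nat_rv i (w : nat -> R) : measurable_fun setT (fun x => w (X i x)).
Proof. exact: (@measurableT_comp _ _ _ _ _ _ w). Qed.

Lemma integral_binomial_sum (w : nat -> R) : (forall k, 0 <= w k) ->
  (\int[P]_x (\sum_i w (X i x))%:E = (#|I|%:R * binomial_mean n p w)%:E)%E.
Proof.
move=> w0; under eq_integral do rewrite -sumEFin.
rewrite ge0_integral_sum//; last 2 first.
- by move=> i; exact/measurable_EFinP/measurable_nat_rv.
- by move=> i x _; rewrite lee_fin.
under eq_bigr do rewrite integral_binomial_rv//.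
by rewrite sumEFin sumr_const mulr_natl.
Qed.

(** Pairwise independence is the case of a two-element subfamily. *)
Lemma probability_pair i j k l : i != j -> (k <= n)%N -> (l <= n)%N ->
  P (X i @^-1` [set k] `&` X j @^-1` [set l]) =
  (binomial_pmf n p k * binomial_pmf n p l)%:E.
Proof.
move=> ij kn ln; have [indX lawX] := iidX.
have lawE h m : (m <= n)%N -> P (X h @^-1` [set m]) = (binomial_pmf n p m)%:E.
  move=> mn; have := lawX h [set m]; rewrite /distribution /pushforward => ->.
  by rewrite /binomial_prob (ltW p_gt0) (ltW p_lt1) esum_set1// lee_fin
    binomial_pmf_ge0// (ltW p_gt0) (ltW p_lt1).
have := indX [set i; j]%SET (fun h => if h == i then [set k] else [set l]).
rewrite big_setU1 ?inE//= big_set1 eqxx eq_sym (negbTE ij) !lawE// EFinM => <-//.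
congr (P _); apply/seteqP; split => x /=.
  by move=> [xi xj] h /=; rewrite !inE => /orP[]/eqP->; rewrite ?eqxx// eq_sym (negbTE ij).
move=> h; split; first by have := h i; rewrite /= !inE eqxx; apply.
by have := h j; rewrite /= !inE eqxx orbT eq_sym (negbTE ij); apply.
Qed.

(** The support condition makes [w] a finite combination of indicators of points,
so that independence of events is enough. *)
Lemma integral_binomial_pair i j (w : nat -> R) : i != j ->
  (forall k, 0 <= w k) -> (forall k, (n < k)%N -> w k = 0) ->
  (\int[P]_x (w (X i x) * w (X j x))%:E = (binomial_mean n p w ^+ 2)%:E)%E.
Proof.
move=> ij w0 wn.
pose A (u : 'I_n.+1 * 'I_n.+1) :=
  X i @^-1` [set nat_of_ord u.1] `&` X j @^-1` [set nat_of_ord u.2].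
have mX h (m : nat) : measurable (X h @^-1` [set m]).
  by rewrite -[X in measurable X]setTI; exact: measurable_funPT.
have wE m : w m = \sum_(k < n.+1) w k * (m == k)%:R.
  have [mn|nm] := ltnP m n.+1.
    rewrite (bigD1 (Ordinal mn))//= eqxx mulr1 big1 ?addr0// => k km.
    by rewrite (_ : m == k = false) ?mulr0//; apply: contraNF km => /eqP mk; exact/eqP/val_inj.
  rewrite wn// big1// => k _; rewrite (_ : m == k = false) ?mulr0//.
  by apply/eqP => mk; move: nm; rewrite mk leqNgt ltn_ord.
transitivity (\int[P]_x \sum_(u : 'I_n.+1 * 'I_n.+1) ((w u.1 * w u.2) * \1_(A u) x)%:E)%E.
  apply: eq_integral => x _; rewrite sumEFin (wE (X i x)) (wE (X j x)).
  rewrite big_distrlr/= pair_bigA/=; congr EFin; apply: eq_bigr => u _.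
  rewrite mulrACA; congr (_ * _); rewrite -natrM mulnb indicE; congr (_%:R).
  congr nat_of_bool; apply/andP/idP; rewrite inE /A /=.
    by case=> /eqP-> /eqP->.
  by case=> -> ->.
have mA u : measurable (A u) by exact: measurableI.
rewrite ge0_integral_sum//; last 2 first.
- by move=> u; apply/measurable_EFinP; apply: measurable_funM => //; exact: measurable_indic.
- by move=> u x _; rewrite lee_fin !mulr_ge0.
transitivity (\sum_(u : 'I_n.+1 * 'I_n.+1)
  (w u.1 * w u.2 * (binomial_pmf n p u.1 * binomial_pmf n p u.2))%:E)%E.
  apply: eq_bigr => u _; under eq_integral do rewrite EFinM.
  rewrite ge0_integralZl_EFin//; last 2 first.
    exact/measurable_EFinP/measurable_indic.
    exact: mulr_ge0.
  rewrite integral_indic// setIT [RHS]EFinM; congr (_ * _)%E.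
  by apply: probability_pair; rewrite // -ltnS.
rewrite sumEFin expr2 /binomial_mean big_distrlr/= pair_bigA/=; congr EFin.
by apply: eq_bigr => u _; rewrite mulrACA; congr (_ * _); rewrite mulrC.
Qed.

(** The off-diagonal terms cancel by pairwise independence.  The square is
expanded as [(W - M e)^2 + 2 M e W = W^2 + (M e)^2], where all terms are
nonnegative, so that no integrability has to be discussed. *)
Lemma variance_binomial_sum (w : nat -> R) :
  (forall k, 0 <= w k) -> (forall k, (n < k)%N -> w k = 0) ->
  (\int[P]_x ((\sum_i w (X i x) - #|I|%:R * binomial_mean n p w) ^+ 2)%:E <=
   (#|I|%:R * binomial_mean n p (fun k => w k ^+ 2))%:E)%E.
Proof.
move=> w0 wn; set e := binomial_mean n p w; set v := binomial_mean n p _.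
set M := #|I|%:R : R; pose W x := \sum_i w (X i x).
have e0 : 0 <= e.
  by apply: sumr_ge0 => k _; rewrite mulr_ge0 ?binomial_pmf_ge0 ?(ltW p_gt0) ?(ltW p_lt1).
have mW : measurable_fun setT W.
  by apply: measurable_sum => i; exact: measurable_nat_rv.
have W0 x : 0 <= W x by exact: sumr_ge0.
have M0 : 0 <= M by [].
have W2 : (\int[P]_x (W x ^+ 2)%:E = (M * v + (M * M - M) * e ^+ 2)%:E)%E.
  transitivity (\int[P]_x \sum_(u : I * I) (w (X u.1 x) * w (X u.2 x))%:E)%E.
    apply: eq_integral => x _; rewrite sumEFin expr2 /W big_distrlr/= pair_bigA//.
  rewrite ge0_integral_sum//; last 2 first.
  - by move=> u; apply/measurable_EFinP; apply: measurable_funM; exact: measurable_nat_rv.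
  - by move=> u x _; rewrite lee_fin mulr_ge0.
  transitivity (\sum_(u : I * I) (if u.1 == u.2 then v else e ^+ 2)%:E)%E.
    apply: eq_bigr => -[i j] _ /=; case: eqVneq => [<-|ij].
      rewrite -(@integral_binomial_rv i)//; first by move=> k; exact: sqr_ge0.
    by rewrite integral_binomial_pair.
  rewrite sumEFin -(pair_bigA _ (fun i j => if i == j then v else e ^+ 2))/=.
  congr EFin; transitivity (\sum_(i : I) (v + (M - 1) * e ^+ 2)).
    apply: eq_bigr => i _; rewrite (bigD1 i)//= eqxx; congr (_ + _).
    rewrite (eq_bigr (fun=> e ^+ 2)); last by move=> j; rewrite eq_sym => /negbTE ->.
    rewrite sumr_const -[LHS]mulr_natl; congr (_ * _).
    rewrite /M [in RHS](cardD1 i) natrD [X in X - 1]addrC addrK; congr _%:R.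
    by apply: eq_card => j; rewrite !inE andbT.
  by rewrite sumr_const -[LHS]mulr_natl -/M; ring.
have key : (\int[P]_x ((W x - M * e) ^+ 2)%:E + (2 * (M * e) * (M * e))%:E =
   (M * v + (M * M - M) * e ^+ 2 + (M * e) ^+ 2)%:E)%E.
  have c0 : 0 <= 2 * (M * e) by rewrite !mulr_ge0.
  rewrite [in X in (_ + X)%E]EFinM -/e -integral_binomial_sum//.
  rewrite -ge0_integralZl_EFin//; last 2 first.
    by move=> x _; rewrite lee_fin; exact: W0.
    exact/measurable_EFinP.
  rewrite -ge0_integralD//; last 4 first.
  - by move=> x _; rewrite lee_fin sqr_ge0.
  - by apply/measurable_EFinP/measurable_funX/measurable_funB.
  - by move=> x _; rewrite -EFinM lee_fin mulr_ge0//; exact: W0.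
  - by apply/measurable_EFinP; apply: measurable_funM.
  rewrite [RHS]EFinD -W2.
  transitivity (\int[P]_x ((W x ^+ 2)%:E + ((M * e) ^+ 2)%:E))%E.
    by apply: eq_integral => x _; rewrite -EFinM -!EFinD; congr EFin; rewrite /W; ring.
  rewrite ge0_integralD//; last 3 first.
  - by move=> x _; rewrite lee_fin sqr_ge0.
  - exact/measurable_EFinP/measurable_funX.
  - by move=> x _; rewrite lee_fin sqr_ge0.
  rewrite integral_cst//= [X in (_ * X)%E](_ : _ = 1%E) ?mule1//.
  exact: probability_setT.
have fin_c : (2 * (M * e) * (M * e))%:E \is a fin_num by [].
rewrite -(leeD2rE _ _ fin_c) key -EFinD lee_fin -subr_ge0.
rewrite (_ : _ - _ = M * e ^+ 2); last by ring.
by rewrite mulr_ge0 ?sqr_ge0.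
Qed.

End IidBinomial.

(** * Binomial mass near the tilted mean *)

Lemma expR_le_quadratic (R : realType) (s : R) :
  s <= 1 / 2 -> expR s <= 1 + s + 2 * s ^+ 2.
Proof.
move=> s12; rewrite -[s in expR s]opprK expRN.
have s1 : 0 < 1 - s by lra.
have h : 1 - s <= expR (- s) by exact: expR_ge1Dx.
apply: (@le_trans _ _ (1 - s)^-1); first by rewrite lef_pV2 ?posrE ?expR_gt0.
rewrite -[leLHS]mul1r ler_pdivrMr// -subr_ge0.
rewrite (_ : _ - _ = s ^+ 2 * (1 - 2 * s)); last by ring.
by rewrite mulr_ge0 ?sqr_ge0//; lra.
Qed.

(** Second order bound on the moment generating function: the linear term [q * s]
is the mean, which is what the Chernoff bound has to beat. *)
Lemma bernoulli_mgf_le_expR (R : realType) (q s : R) : 0 <= q -> s <= 1 / 2 ->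
  q * expR s + (1 - q) <= expR (q * s + 2 * q * s ^+ 2).
Proof.
move=> q0 /expR_le_quadratic hs; apply: le_trans (expR_ge1Dx _).
have : q * expR s <= q * (1 + s + 2 * s ^+ 2) by rewrite ler_wpM2l.
lra.
Qed.

Section BinomialMean.
Context {R : realType} {p : R}.
Hypotheses (p_gt0 : 0 < p) (p_lt1 : p < 1).

Local Notation f := (annealed_free_energy p).
Local Notation D := (trial_laplace p).
Local Notation q := (tilted_mean p).

Lemma le_binomial_mean n (v w : nat -> R) :
  (forall k, (k <= n)%N -> v k <= w k) -> binomial_mean n p v <= binomial_mean n p w.
Proof.
move=> vw; apply: ler_sum => k _; rewrite ler_wpM2l ?vw -1?ltnS//.
by rewrite binomial_pmf_ge0// (ltW p_gt0) (ltW p_lt1).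
Qed.

Lemma binomial_meanD n (v w : nat -> R) :
  binomial_mean n p (fun k => v k + w k) = binomial_mean n p v + binomial_mean n p w.
Proof. by rewrite -big_split/=; apply: eq_bigr => k _; rewrite mulrDr. Qed.

Lemma binomial_meanZ n c (w : nat -> R) :
  binomial_mean n p (fun k => c * w k) = c * binomial_mean n p w.
Proof. by rewrite mulr_sumr; apply: eq_bigr => k _; rewrite mulrCA. Qed.

Lemma binomial_mean_expR n b :
  binomial_mean n p (fun k => expR (- b * k%:R)) = D b ^+ n.
Proof.
rewrite /trial_laplace addrC exprDn; apply: eq_bigr => k _.
rewrite /binomial_pmf expRM_natr exprMn mulrnAl; congr (_ *+ _).
by rewrite -mulrA mulrCA.
Qed.

(** Boltzmann weight at [b], restricted to values within [eps * n] of the tilted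
mean.  The lower cut controls the second moment, the upper one the passage to
larger inverse temperatures. *)
Definition window_weight (b eps : R) (n k : nat) : R :=
  if (k <= n)%N && (`|k%:R - q b * n%:R| <= eps * n%:R)
  then expR (- b * k%:R) else 0.

Lemma window_weight_ge0 b eps n k : 0 <= window_weight b eps n k.
Proof. by rewrite /window_weight; case: ifP => // _; exact: expR_ge0. Qed.

Lemma window_weight_out b eps n k : (n < k)%N -> window_weight b eps n k = 0.
Proof. by rewrite /window_weight ltnNge => /negbTE ->. Qed.

(** On the window [k >= (q b - eps) * n], so one of the two Boltzmann factors is
small. *)
Lemma window_weight_sqr b eps n k : 0 <= b ->
  window_weight b eps n k ^+ 2 <=
  expR (- (b * (q b - eps)) * n%:R) * window_weight b eps n k.
Proof.
rewrite /window_weight => b0; case: ifP => [/andP[_]|_]; last by rewrite expr0n mulr0.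
rewrite ler_norml expr2 => /andP[hk _]; rewrite ler_wpM2r ?expR_ge0// ler_expR.
by rewrite !mulNr lerN2 -mulrA ler_wpM2l//; lra.
Qed.

(** On the window [k <= (q b + eps) * n], which bounds the cost of raising the
inverse temperature. *)
Lemma window_weight_shift b b' eps n k : b <= b' ->
  expR (- ((b' - b) * (q b + eps)) * n%:R) * window_weight b eps n k <=
  expR (- b' * k%:R).
Proof.
rewrite /window_weight => bb'; case: ifP => [/andP[_]|_]; last first.
  by rewrite mulr0 expR_ge0.
rewrite ler_norml => /andP[_ hk]; rewrite -expRD ler_expR.
have : (b' - b) * k%:R <= (b' - b) * ((q b + eps) * n%:R).
  by rewrite ler_wpM2l ?subr_ge0//; lra.
lra.
Qed.

(** The Chernoff bound for one trial; [t = eps / 4] serves the lower tail and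
[t = - eps / 4] the upper one.  With this choice the quadratic error
[2 * q b * t^2 <= eps^2 / 8] is half of the gain [eps^2 / 4]. *)
Lemma tail_laplace_le b eps t : `|t| = eps / 4 -> eps <= 1 -> 
  expR (t * q b - eps ^+ 2 / 4) * D (b + t) <= D b * expR (- (eps ^+ 2 / 8)).
Proof.
move=> teps eps1; rewrite trial_laplaceD// mulrCA ler_pM2l ?trial_laplace_gt0//.
have t12 : - t <= 1 / 2 by have := ler_norm (- t); rewrite normrN teps; lra.
apply: (@le_trans _ _ (expR (t * q b - eps ^+ 2 / 4) *
    expR (q b * - t + 2 * q b * (- t) ^+ 2))).
  by rewrite ler_wpM2l ?expR_ge0// bernoulli_mgf_le_expR// ltW ?tilted_mean_gt0.
rewrite -expRD ler_expR sqrrN -(real_normK (num_real t)) teps.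
have : q b * eps ^+ 2 <= 1 * eps ^+ 2.
  by rewrite ler_wpM2r ?sqr_ge0 ?ltW ?tilted_mean_lt1.
lra.
Qed.

(** The full sum is [D b ^+ n]; each of the two tails outside the window is
dominated by an exponentially reweighted full sum. *)
Lemma window_mass b eps n : 0 < eps -> eps <= 1 ->
  D b ^+ n * (1 - 2 * expR (- (eps ^+ 2 / 8)) ^+ n) <=
  binomial_mean n p (window_weight b eps n).
Proof.
move=> eps0 eps1; set rho := expR (- (eps ^+ 2 / 8)).
(* up to the Boltzmann weight this is [expR (- t * (k - q b * n) - eps^2 / 4 * n)],
   which is at least 1 on the lower tail if [t = eps / 4], and on the upper tail
   if [t = - eps / 4] *)
pose tail t k := expR (t * q b - eps ^+ 2 / 4) ^+ n * expR (- (b + t) * k%:R).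
have tailE t k : tail t k = expR (- b * k%:R - t * (k%:R - q b * n%:R) - eps ^+ 2 / 4 * n%:R).
  by rewrite /tail -expRM_natr -expRD; congr expR; ring.
have mean_tail t : `|t| = eps / 4 -> binomial_mean n p (tail t) <= D b ^+ n * rho ^+ n.
  move=> ht; rewrite /tail binomial_meanZ binomial_mean_expR -!exprMn.
  apply: lerXn2r; last exact: tail_laplace_le.
  - by rewrite nnegrE mulr_ge0 ?expR_ge0 ?ltW ?trial_laplace_gt0.
  - by rewrite nnegrE mulr_ge0 ?expR_ge0 ?ltW ?trial_laplace_gt0.
have := @le_binomial_mean n (fun k => expR (- b * k%:R))
  (fun k => window_weight b eps n k + (tail (eps / 4) k + tail (- (eps / 4)) k)).
rewrite binomial_mean_expR !binomial_meanD => mean_le.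
have {}mean_le := mean_le _.
have eps4 : `|eps / 4| = eps / 4 by rewrite ger0_norm// divr_ge0// ltW.
suff h : D b ^+ n <= binomial_mean n p (window_weight b eps n) +
  (binomial_mean n p (tail (eps / 4)) + binomial_mean n p (tail (- (eps / 4)))).
  have h1 := mean_tail _ eps4.
  have h2 := mean_tail (- (eps / 4)); rewrite normrN in h2.
  by have {}h2 := h2 eps4; rewrite mulrBr mulr1; lra.
apply: mean_le => k kn; rewrite /window_weight kn/=; case: ifPn.
  by rewrite lerDl !tailE addr_ge0 ?expR_ge0.
rewrite -ltNge add0r lter_normr => /orP[hk|hk].
  rewrite -[leLHS]add0r lerD ?tailE ?expR_ge0// ler_expR.
  have : eps / 4 * (eps * n%:R) <= eps / 4 * (k%:R - q b * n%:R).
    by rewrite ler_wpM2l ?divr_ge0// ltW.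
  lra.
rewrite -[leLHS]addr0 lerD ?tailE ?expR_ge0// ler_expR.
have : eps / 4 * (eps * n%:R) <= eps / 4 * - (k%:R - q b * n%:R).
  by rewrite ler_wpM2l ?divr_ge0// ltW.
lra.
Qed.

End BinomialMean.

(** * Almost sure bounds at a fixed inverse temperature *)

Section AlmostSure.
Context {R : realType} {d : measure_display} {T : measurableType d}.
Context {P : probability T R} {p : R}.
Hypotheses (p_gt0 : 0 < p) (p_lt1 : p < 1).
Variable H : forall N : nat, config N -> {RV P >-> nat}.
Hypothesis iidH : forall N : nat, (0 < N)%N -> iid_binomial N p (@H N).

Local Notation f := (annealed_free_energy p).
Local Notation D := (trial_laplace p).
Local Notation q := (tilted_mean p).
Local Notation Z N := (partition_function (@H N)).

Lemma card_config N : #|{: config N}| = (2 ^ N)%N.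
Proof. by rewrite card_ffun card_bool card_ord. Qed.

Lemma integral_partition_function N b : (0 < N)%N ->
  (\int[P]_x (Z N b x)%:E = (expR (N%:R * f b))%:E)%E.
Proof.
move=> N0; rewrite /partition_function.
rewrite (integral_binomial_sum p_gt0 p_lt1 (iidH N0)
  (w := fun k => expR (- b * k%:R))); last by move=> k; exact: expR_ge0.
by rewrite binomial_mean_expR card_config expRM_natl expR_annealed// exprMn natrX.
Qed.

Lemma measurable_partition N b : measurable_fun setT (Z N b).
Proof.
apply: measurable_sum => sigma.
exact: (measurable_nat_rv (@H N) sigma (fun k => expR (- b * k%:R))).
Qed.

Lemma ae_partition_upper b eps : 0 < eps ->
  {ae P, forall x, \forall N \near \oo, Z N b x < expR (N%:R * (f b + eps))}.
Proof.
move=> eps0.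
pose X N x := expR (- (N%:R * (f b + eps))) * Z N b x.
have Z0 N x : 0 <= Z N b x by apply: sumr_ge0 => sigma _; exact: expR_ge0.
have mX N : measurable_fun setT (X N).
  by apply: measurable_funM => //; exact: measurable_partition.
have X0 N x : 0 <= X N x by rewrite mulr_ge0 ?expR_ge0.
have e1 : expR (- eps) < 1 by rewrite expR_lt1 oppr_lt0.
have hX : \forall N \near \oo,
    (\int[P]_x (X N x)%:E <= (1 * expR (- eps) ^+ N)%:E)%E.
  exists 1%N => // N /= N0.
  under eq_integral do rewrite EFinM.
  rewrite ge0_integralZl_EFin ?expR_ge0//; last 2 first.
    by move=> x _; rewrite lee_fin.
    exact/measurable_EFinP/measurable_partition.
  rewrite integral_partition_function// -EFinM lee_fin -expRM_natl -expRD mul1r ler_expR.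
  lra.
apply: filterS (ae_eventually_lt1 mX X0 (expR_gt0 _) e1 hX) => x.
apply: filterS => N; rewrite /X expRN.
by rewrite ltr_pdivrMl ?expR_gt0// mulr1.
Qed.

(** Chebyshev's inequality for the windowed partition function [W], with mean [m]:
its relative variance is bounded by a multiple of
[expR (- (f b + b * (q b - eps))) ^+ N].  The conclusion is uniform in [b']
because the event concerns [b] only. *)
Lemma ae_partition_lower b eps : 0 <= b -> 0 < eps -> eps <= 1 ->
  0 < f b + b * (q b - eps) ->
  {ae P, forall x, \forall N \near \oo, forall b', b <= b' ->
    expR (N%:R * (f b - (b' - b) * (q b + eps))) / 4 < Z N b' x}.
Proof.
move=> b0 eps0 eps1 rate_gt0.
pose w N := window_weight b eps N (p := p).
pose W N x := \sum_(sigma : config N) w N (H sigma x).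
pose m N := #|{: config N}|%:R * binomial_mean N p (w N).
(* [X N x < 1] forces [W N x > m N / 2] *)
pose X N x := (4 / m N ^+ 2) * (W N x - m N) ^+ 2.
have mW N : measurable_fun setT (W N).
  by apply: measurable_sum => sigma; exact: measurable_nat_rv.
have mX N : measurable_fun setT (X N).
  by apply: measurable_funM => //; apply: measurable_funX; exact: measurable_funB.
have X0 N x : 0 <= X N x by rewrite mulr_ge0 ?divr_ge0 ?sqr_ge0.
(* the two tails of the window are at most half of the mass eventually *)
have m_large : \forall N \near \oo, expR (N%:R * f b) / 2 <= m N.
  have : (fun N => 2 * expR (- (eps ^+ 2 / 8)) ^+ N) @ \oo --> (2 * 0 : R).
    apply: cvgM; first exact: cvg_cst.
    apply: cvg_expr; rewrite ger0_norm ?expR_ge0// expR_lt1 oppr_lt0.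
    by rewrite divr_gt0 ?exprn_gt0.
  rewrite mulr0 => /cvgr_lt/(_ (1 / 2) _)[//|N0 _ hN].
  exists N0 => // N /hN /= hN'.
  rewrite expRM_natl expR_annealed// exprMn /m card_config natrX -mulrA.
  rewrite ler_pM2l ?exprn_gt0//; apply: le_trans (window_mass p_gt0 p_lt1 b N eps0 eps1).
  rewrite ler_pM2l ?exprn_gt0 ?trial_laplace_gt0//; lra.
have e1 : expR (- (f b + b * (q b - eps))) < 1 by rewrite expR_lt1 oppr_lt0.
have hX : \forall N \near \oo,
    (\int[P]_x (X N x)%:E <= (8 * expR (- (f b + b * (q b - eps))) ^+ N)%:E)%E.
  near=> N.
  have mN : expR (N%:R * f b) / 2 <= m N by near: N.
  have N_gt0 : (0 < N)%N by near: N; exists 1%N.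
  have m_gt0 : 0 < m N by apply: lt_le_trans mN; rewrite divr_gt0 ?expR_gt0.
  have c_ge0 : 0 <= 4 / m N ^+ 2 by rewrite divr_ge0 ?sqr_ge0.
  under eq_integral do rewrite EFinM.
  rewrite ge0_integralZl_EFin//; last 2 first.
    by move=> x _; rewrite lee_fin sqr_ge0.
    by apply/measurable_EFinP/measurable_funX/measurable_funB.
  have w0 k : 0 <= w N k by exact: window_weight_ge0.
  have wN k : (N < k)%N -> w N k = 0 by exact: window_weight_out.
  have c_ge0E : (0 <= (4 / m N ^+ 2)%:E)%E by rewrite lee_fin.
  have var_le := variance_binomial_sum p_gt0 p_lt1 (iidH N_gt0) w0 wN.
  apply: (le_trans (lee_wpmul2l c_ge0E var_le)).
  rewrite -EFinM lee_fin.
  have v_le : #|{: config N}|%:R * binomial_mean N p (fun k => w N k ^+ 2) <=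
      expR (- (b * (q b - eps)) * N%:R) * m N.
    rewrite /m mulrCA ler_wpM2l// -binomial_meanZ.
    by apply: le_binomial_mean => // k _; exact: window_weight_sqr.
  apply: le_trans (ler_wpM2l c_ge0 v_le) _.
  have -> : 4 / m N ^+ 2 * (expR (- (b * (q b - eps)) * N%:R) * m N) =
      4 * expR (- (b * (q b - eps)) * N%:R) / m N.
    by field; rewrite gt_eqF.
  rewrite ler_pdivrMr// -expRM_natl.
  have -> : N%:R * - (f b + b * (q b - eps)) =
      - (b * (q b - eps)) * N%:R + - (N%:R * f b) by ring.
  rewrite expRD [expR (- (N%:R * _))]expRN.
  have : 1 / 2 <= (expR (N%:R * f b))^-1 * m N.
    by rewrite ler_pdivlMl ?expR_gt0// mul1r.
  move: (expR_ge0 (- (b * (q b - eps)) * N%:R)); set E1 := expR _ => E10 h.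
  have : E1 * (1 / 2) <= E1 * ((expR (N%:R * f b))^-1 * m N) by rewrite ler_wpM2l.
  lra.
have := ae_eventually_lt1 mX X0 (expR_gt0 _) e1 hX; apply: filterS => x Xx.
near=> N => b' bb'.
have mN : expR (N%:R * f b) / 2 <= m N by near: N.
have m_gt0 : 0 < m N by apply: lt_le_trans mN; rewrite divr_gt0 ?expR_gt0.
have WN : m N / 2 < W N x.
  have : X N x < 1 by near: N.
  rewrite /X mulrAC ltr_pdivrMr ?exprn_gt0// mul1r ltNge => /negP h.
  rewrite ltNge; apply/negP => Wm; apply: h.
  rewrite -subr_ge0 (_ : _ - _ = (m N - 2 * W N x) * (3 * m N - 2 * W N x)); last by ring.
  by rewrite mulr_ge0//; lra.
apply: (@lt_le_trans _ _ (expR (- ((b' - b) * (q b + eps)) * N%:R) * W N x)).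
  have -> : N%:R * (f b - (b' - b) * (q b + eps)) =
      - ((b' - b) * (q b + eps)) * N%:R + N%:R * f b by ring.
  rewrite expRD -mulrA ltr_pM2l ?expR_gt0//; lra.
rewrite mulr_sumr; apply: ler_sum => sigma _; exact: window_weight_shift.
Unshelve. all: by end_near.
Qed.

End AlmostSure.

(** * The quenched free energy at all inverse temperatures *)

Lemma ae_forall_countable (R : realType) (d : measure_display)
    (T : measurableType d) (P : probability T R) (I : countType)
    (Q : I -> T -> Prop) :
  (forall i, {ae P, forall x, Q i x}) -> {ae P, forall x, forall i, Q i x}.
Proof.
move=> aeQ.
have : {ae P, forall x, forall n, forall i, unpickle n = Some i -> Q i x}.
  apply: ae_foralln => n; case: (unpickle n) => [i|].
    by apply: filterS (aeQ i) => x Qx _ [<-].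
  by apply: filterE => x.
by apply: filterS => x Qx i; apply: (Qx (pickle i)); rewrite pickleK.
Qed.

Section Quenched.
Context {R : realType} {p : R}.
Hypotheses (p_gt0 : 0 < p) (p_lt1 : p < 1).

Local Notation f := (annealed_free_energy p).
Local Notation q := (tilted_mean p).
Local Notation g := (tilted_entropy p).

(* In this section one realisation [h] of the energies is fixed, and the bounds
   at a fixed inverse temperature are assumed on a dense set [A] only. *)
Variable A : set R.
Hypotheses (A0 : A 0)
  (A_dense : forall x y, x < y -> exists a, [/\ A a, x < a & a < y]).

Variable h : forall N : nat, config N -> nat.

Definition gibbs_sum N (b : R) : R := \sum_sigma expR (- b * (@h N sigma)%:R).

Local Notation F N b := (1 / N%:R * ln (gibbs_sum N b)).

Lemma gibbs_sum_gt0 N b : 0 < gibbs_sum N b.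
Proof.
rewrite /gibbs_sum (bigD1 [ffun=> true])//= ltr_wpDr ?expR_gt0//.
by apply: sumr_ge0 => sigma _; exact: expR_ge0.
Qed.

Lemma gibbs_sum_anti N a b : a <= b -> gibbs_sum N b <= gibbs_sum N a.
Proof.
by move=> ab; apply: ler_sum => s _; rewrite ler_expR !mulNr lerN2 ler_wpM2r.
Qed.

(** The sum of the powers [x_i ^ s], [s = b / a >= 1], is at most the power [s] of
the sum of the [x_i >= 0]; here [x_i] is the weight at [a]. *)
Lemma ln_gibbs_sum_scaling N a b : 0 < a -> a <= b ->
  ln (gibbs_sum N b) <= b / a * ln (gibbs_sum N a).
Proof.
move=> a0 ab; set Za := gibbs_sum N a; have Za0 : 0 < Za := gibbs_sum_gt0 N a.
set L := ln Za; have ZaE : expR L = Za by rewrite lnK.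
rewrite -ler_expR lnK ?posrE ?gibbs_sum_gt0//.
have -> : expR (b / a * L) = \sum_sigma expR ((b / a - 1) * L) * expR (- a * (@h N sigma)%:R).
  by rewrite -mulr_sumr -/(gibbs_sum N a) -/Za -ZaE -expRD; congr expR; ring.
apply: ler_sum => sigma _; rewrite -expRD ler_expR.
have term_le : - a * (@h N sigma)%:R <= L.
  rewrite -ler_expR ZaE /Za /gibbs_sum (bigD1 sigma)//= lerDl.
  by apply: sumr_ge0 => s _; exact: expR_ge0.
have s1 : 0 <= b / a - 1 by rewrite subr_ge0 ler_pdivlMr// mul1r.
have -> : - b * (@h N sigma)%:R = (b / a - 1) * (- a * (@h N sigma)%:R) + - a * (@h N sigma)%:R.
  by field; rewrite gt_eqF.
by rewrite lerD2r ler_wpM2l.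
Qed.

Lemma free_energy_le N b c : (0 < N)%N ->
  (F N b <= c) = (gibbs_sum N b <= expR (N%:R * c)).
Proof.
move=> N0; rewrite div1r ler_pdivrMl ?ltr0n//.
by rewrite -[LHS]ler_expR lnK ?posrE ?gibbs_sum_gt0.
Qed.

Lemma free_energy_ge N b c : (0 < N)%N ->
  (c <= F N b) = (expR (N%:R * c) <= gibbs_sum N b).
Proof.
move=> N0; rewrite div1r ler_pdivlMl ?ltr0n//.
by rewrite -[LHS]ler_expR lnK ?posrE ?gibbs_sum_gt0.
Qed.

Hypothesis upperA : forall a e, A a -> A e -> 0 < e -> \forall N \near \oo,
  gibbs_sum N a < expR (N%:R * (f a + e)).

(** Compare with a slightly smaller [a] in [A]: [gibbs_sum] decreases and [f] is
Lipschitz. *)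
Lemma free_energy_upper b eps : 0 < eps -> \forall N \near \oo, F N b <= f b + eps.
Proof.
move=> eps0; have eps2 : 0 < eps / 2 by lra.
have [e [Ae e0 e_eps]] := A_dense eps2.
have b_lt : b - eps / 2 < b by lra.
have [a [Aa a_gt a_lt]] := A_dense b_lt.
near=> N; rewrite free_energy_le; last by near: N; exists 1%N.
apply: le_trans (gibbs_sum_anti N (ltW a_lt)) _.
have /ltW/le_trans -> // : gibbs_sum N a < expR (N%:R * (f a + e)).
  by near: N; exact: upperA.
rewrite ler_expR ler_wpM2l//.
have := annealed_lipschitz p_gt0 p_lt1 (ltW a_lt); lra.
Unshelve. all: by end_near.
Qed.

Lemma free_energy_upper_frozen b0 b eps : 0 < b0 -> g b0 = 0 -> b0 <= b -> 0 < eps ->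
  \forall N \near \oo, F N b <= - b * q b0 + eps.
Proof.
move=> b0_gt0 gb0 b0b eps0; have b_gt0 : 0 < b := lt_le_trans b0_gt0 b0b.
have eps'0 : 0 < eps * (b0 / b) by rewrite mulr_gt0 ?divr_gt0.
near=> N.
have N_gt0 : (0 < N)%N by near: N; exists 1%N.
have Fb0 : F N b0 <= f b0 + eps * (b0 / b) by near: N; exact: free_energy_upper.
have Fb : F N b <= b / b0 * F N b0.
  by rewrite mulrCA ler_wpM2l ?div1r ?invr_ge0// ln_gibbs_sum_scaling.
apply: le_trans Fb _.
have s_ge0 : 0 <= b / b0 by rewrite divr_ge0 ?ltW.
apply: le_trans (ler_wpM2l s_ge0 Fb0) _.
have -> : f b0 = - (b0 * q b0) by apply/eqP; rewrite -addr_eq0; apply/eqP.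
rewrite le_eqVlt; apply/orP; left; apply/eqP; field; rewrite !gt_eqF//.
Unshelve. all: by end_near.
Qed.

Hypothesis lowerA : forall a e, A a -> A e -> 0 <= a -> 0 < e -> e <= 1 ->
  0 < f a + a * (q a - e) ->
  \forall N \near \oo, forall b, a <= b ->
    expR (N%:R * (f a - (b - a) * (q a + e))) / 4 < gibbs_sum N b.

(** The positivity of [g a] leaves room for a window of positive width [e]; its
contribution [(b - a) * e] to the slope and the factor 4 are absorbed in [eps]. *)
Lemma free_energy_tangent_lower a b eps :
  A a -> 0 <= a -> 0 < g a -> a <= b -> 0 < eps ->
  \forall N \near \oo, f a - (b - a) * q a - eps <= F N b.
Proof.
move=> Aa a0 ga ab eps0.
have b1 : 0 < b + 1 by rewrite ltr_wpDl// (le_trans a0).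
pose bound := Num.min (b + 1) (Num.min (eps / 2) (g a)) / (b + 1).
have bound0 : 0 < bound by rewrite divr_gt0// !lt_min b1 ga divr_gt0.
have [e [Ae e0]] := A_dense bound0.
rewrite /bound ltr_pdivlMr// !lt_min => /and3P[n_1 n_eps n_g].
have e1 : e <= 1 by rewrite -(ler_pM2r b1) mul1r ltW.
have rate : 0 < f a + a * (q a - e).
  have : e * a <= e * (b + 1) by rewrite ler_pM2l//; lra.
  rewrite /tilted_entropy in n_g; lra.
have slope : (b - a) * e <= eps / 2.
  have : (b - a) * e <= (b + 1) * e by rewrite ler_pM2r//; lra.
  rewrite [(b + 1) * e]mulrC; lra.
near=> N.
have N_gt0 : (0 < N)%N by near: N; exists 1%N.
rewrite free_energy_ge//.
have /(_ b ab) low : forall b, a <= b ->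
    expR (N%:R * (f a - (b - a) * (q a + e))) / 4 < gibbs_sum N b.
  by near: N; exact: lowerA.
apply: le_trans (ltW low).
(* [1 + N * eps / 2 >= 4] *)
have N_large : 6 / eps <= N%:R by near: N; exact: nbhs_infty_ger.
have ln4 : 4 <= expR (N%:R * (eps / 2)).
  apply: le_trans (expR_ge1Dx _).
  rewrite ler_pdivrMr// in N_large; lra.
rewrite ler_pdivlMr//.
apply: le_trans (ler_wpM2l (expR_ge0 _) ln4) _.
rewrite -expRD ler_expR -mulrDr ler_wpM2l//; lra.
Unshelve. all: by end_near.
Qed.

(** Tangents at points [a] slightly below [b]; [g a > g b > 0] by monotonicity. *)
Lemma free_energy_lower b eps : 0 <= b -> 0 < g b -> 0 < eps ->
  \forall N \near \oo, f b - eps <= F N b.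
Proof.
rewrite le_eqVlt => /predU1P[<-|b0] gb eps0.
  have := @free_energy_tangent_lower 0 0 eps A0.
  by rewrite subrr mul0r subr0; apply.
have b_lt : Num.max 0 (b - eps / 2) < b by rewrite gt_max b0; lra.
have [a [Aa]] := A_dense b_lt.
rewrite gt_max => /andP[a0 a_gt] a_lt.
have ga : 0 < g a by rewrite (lt_trans gb)// tilted_entropy_anti// ltW.
have eps2 : 0 < eps / 2 by lra.
have := free_energy_tangent_lower Aa (ltW a0) ga (ltW a_lt) eps2.
apply: filterS => N; apply: le_trans.
have fr := annealed_tangent p_gt0 p_lt1 (negbT (lt_eqF a_lt)).
have qb : 0 <= q b * (b - a).
  by rewrite mulr_ge0 ?subr_ge0 ?ltW// tilted_mean_gt0.
have qr : (b - a) * q a <= (b - a) * 1.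
  by rewrite ler_wpM2l ?subr_ge0 ?ltW// tilted_mean_lt1.
lra.
Qed.

(** The tangent at [a < b0] has value [g a - b * q a >= - b * q a] at [b], and
[q a] tends to [q b0] as [a] increases to [b0]. *)
Lemma free_energy_lower_frozen b0 b eps : 0 < b0 -> g b0 = 0 -> b0 <= b -> 0 < eps ->
  \forall N \near \oo, - b * q b0 - eps <= F N b.
Proof.
move=> b0_gt0 gb0 b0b eps0; have b_gt0 : 0 < b := lt_le_trans b0_gt0 b0b.
pose delta := Num.min (1 / 2) (eps / (4 * (b + 1))).
have b1 : 0 < 4 * (b + 1) by lra.
have delta_gt0 : 0 < delta by rewrite lt_min !divr_gt0.
have b0_lt : Num.max 0 (b0 - delta) < b0 by rewrite gt_max b0_gt0; lra.
have [a [Aa]] := A_dense b0_lt.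
rewrite gt_max => /andP[a0 a_gt] a_lt.
have ga : 0 < g a by rewrite -gb0 tilted_entropy_anti// ltW.
have eps2 : 0 < eps / 2 by lra.
have ab : a <= b by rewrite ltW// (lt_le_trans a_lt).
have := free_energy_tangent_lower Aa (ltW a0) ga ab eps2.
apply: filterS => N; apply: le_trans.
set u := b0 - a; have u_delta : u < delta by rewrite /u; lra.
have u0 : 0 < u by rewrite subr_gt0.
have [u12 u_eps] : u <= 1 / 2 /\ b * u <= eps / 4.
  move: u_delta; rewrite lt_min => /andP[/ltW -> ]; rewrite ltr_pdivlMr// => ub.
  by split=> //; lra.
have expu : expR u <= 1 + 2 * u.
  apply: le_trans (expR_le_quadratic u12) _.
  have : u * u <= u * (1 / 2) by rewrite ler_pM2l.
  lra.
have q_le : q a <= q b0 + 2 * u.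
  have := tilted_mean_le_expR p_gt0 p_lt1 (ltW a_lt); rewrite -/u => qr.
  have q1 := tilted_mean_lt1 p_gt0 p_lt1 b0.
  have q0 := tilted_mean_gt0 p_gt0 p_lt1 b0.
  have : expR u * q b0 <= (1 + 2 * u) * q b0 by rewrite ler_pM2r.
  have : 2 * u * q b0 <= 2 * u * 1 by rewrite ler_wpM2l//; lra.
  lra.
have : b * q a <= b * (q b0 + 2 * u) by rewrite ler_pM2l.
move: ga; rewrite /tilted_entropy; lra.
Qed.

Lemma cvg_free_energy b l :
  (forall eps, 0 < eps -> \forall N \near \oo, F N b <= l + eps) ->
  (forall eps, 0 < eps -> \forall N \near \oo, l - eps <= F N b) ->
  F N b @[N --> \oo] --> l.
Proof.
move=> hU hL; apply/cvgrPdist_le => eps eps0; near=> N.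
rewrite ler_distlC; apply/andP; split.
  by near: N; exact: hL.
by near: N; exact: hU.
Unshelve. all: by end_near.
Qed.

Lemma cvg_free_energy_annealed b : 0 <= b -> 0 < g b ->
  F N b @[N --> \oo] --> f b.
Proof.
move=> b0 gb; apply: cvg_free_energy => eps eps0.
  exact: free_energy_upper.
exact: free_energy_lower.
Qed.

Lemma cvg_free_energy_frozen b0 b : 0 < b0 -> g b0 = 0 -> b0 <= b ->
  F N b @[N --> \oo] --> - b * q b0.
Proof.
move=> b0_gt0 gb0 b0b; apply: cvg_free_energy => eps eps0.
  exact: free_energy_upper_frozen.
exact: free_energy_lower_frozen.
Qed.

End Quenched.

(** Both convergence regimes hold off the union of the null sets belonging to the
countably many rational temperatures and tolerances. *)
Lemma ae_cvg_free_energy (R : realType) (d : measure_display)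
    (T : measurableType d) (P : probability T R) (p : R)
    (p_gt0 : 0 < p) (p_lt1 : p < 1)
    (H : forall N : nat, config N -> {RV P >-> nat})
    (iidH : forall N : nat, (0 < N)%N -> iid_binomial N p (H N)) :
  {ae P, forall x,
    (forall b, 0 <= b -> 0 < tilted_entropy p b ->
      (1 / N%:R * ln (partition_function (H N) b x)) @[N --> \oo] -->
        annealed_free_energy p b) /\
    (forall b0 b, 0 < b0 -> tilted_entropy p b0 = 0 -> b0 <= b ->
      (1 / N%:R * ln (partition_function (H N) b x)) @[N --> \oo] -->
        - b * tilted_mean p b0)}.
Proof.
pose A : set R := range (@ratr R).
have A0 : A 0 by exists 0 => //; rewrite rmorph0.
have A_dense x y : x < y -> exists a, [/\ A a, x < a & a < y].
  move=> /rat_in_itvoo[r]; rewrite in_itv/= => /andP[xr ry].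
  by exists (ratr r); split => //; exists r.
have upper : {ae P, forall x, forall r : rat * rat, 0 < ratr r.2 :> R ->
    \forall N \near \oo, partition_function (H N) (ratr r.1) x <
      expR (N%:R * (annealed_free_energy p (ratr r.1) + ratr r.2))}.
  apply: ae_forall_countable => -[r s] /=.
  have [s0|s0] := ltP 0 (ratr s : R); last by apply: filterE.
  by apply: filterS (ae_partition_upper p_gt0 p_lt1 iidH (ratr r) s0) => x hx _.
have lower : {ae P, forall x, forall r : rat * rat,
    0 <= ratr r.1 :> R -> 0 < ratr r.2 :> R -> ratr r.2 <= 1 :> R ->
    0 < annealed_free_energy p (ratr r.1) +
      ratr r.1 * (tilted_mean p (ratr r.1) - ratr r.2) ->
    \forall N \near \oo, forall b, ratr r.1 <= b ->
      expR (N%:R * (annealed_free_energy p (ratr r.1) -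
        (b - ratr r.1) * (tilted_mean p (ratr r.1) + ratr r.2))) / 4 <
      partition_function (H N) b x}.
  apply: ae_forall_countable => -[r s] /=.
  have [r0|r0] := leP 0 (ratr r : R); last by apply: filterE.
  have [s0|s0] := ltP 0 (ratr s : R); last by apply: filterE.
  have [s1|s1] := leP (ratr s : R) 1; last by apply: filterE.
  have [rate|rate] := ltP 0 (annealed_free_energy p (ratr r) +
      ratr r * (tilted_mean p (ratr r) - ratr s)); last by apply: filterE.
  by apply: filterS (ae_partition_lower p_gt0 p_lt1 iidH r0 s0 s1 rate) => x hx _ _ _ _.
apply: filterS2 upper lower => x up low.
pose h N sigma := H N sigma x.
have upperA a e : A a -> A e -> 0 < e -> \forall N \near \oo,
    gibbs_sum h N a < expR (N%:R * (annealed_free_energy p a + e)).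
  by move=> [r _ <-] [s _ <-]; exact: (up (r, s)).
have lowerA a e : A a -> A e -> 0 <= a -> 0 < e -> e <= 1 ->
    0 < annealed_free_energy p a + a * (tilted_mean p a - e) ->
    \forall N \near \oo, forall b, a <= b ->
      expR (N%:R * (annealed_free_energy p a - (b - a) * (tilted_mean p a + e))) / 4 <
      gibbs_sum h N b.
  by move=> [r _ <-] [s _ <-]; exact: (low (r, s)).
split.
  move=> b b_ge0 gb.
  exact: (cvg_free_energy_annealed p_gt0 p_lt1 A0 A_dense upperA lowerA b_ge0 gb).
move=> b0 b b0_gt0 gb0 b0b.
exact: (cvg_free_energy_frozen p_gt0 p_lt1 A_dense upperA lowerA b0_gt0 gb0 b0b).
Qed.

Theorem theorem1p5p4 (R : realType) (d : measure_display)
    (T : measurableType d) (P : probability T R) (p : R)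
    (hp0 : 0 < p) (hp1 : p < 1)
    (H : forall N : nat, config N -> {RV P >-> nat})
    (hH : forall N : nat, (0 < N)%N -> iid_binomial N p (H N)) :
  (p <= 1 / 2 ->
    {ae P, forall omega : T, forall beta : R, 0 <= beta ->
      (1 / N%:R * ln (partition_function (H N) beta omega))
        @[N --> \oo] --> annealed_free_energy p beta}) /\
  (1 / 2 < p ->
    exists x1 beta0 : R,
      [/\ unique (fun x : R => [/\ 0 < x, x < p & relative_entropy p x = ln 2])
            x1,
          unique (fun b : R => 0 < b /\ p / (p + (1 - p) * expR b) = x1)
            beta0 &
          {ae P, forall omega : T, forall beta : R, 0 <= beta ->
            (1 / N%:R * ln (partition_function (H N) beta omega))
              @[N --> \oo] -->
            (if beta <= beta0 then annealed_free_energy p beta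
             else - beta * x1)}]).
Proof.
have bounds := ae_cvg_free_energy hp0 hp1 hH.
split=> [p_le|p_gt].
  apply: filterS bounds => omega [annealed _] beta beta_ge0.
  by apply: annealed; rewrite ?tilted_entropy_gt0.
have [b0 b0_gt0 gb0] := tilted_entropy_zero hp0 hp1 p_gt.
have entropy_pos b : 0 <= b -> b < b0 -> 0 < tilted_entropy p b.
  by move=> b_ge0 bb0; rewrite -gb0 tilted_entropy_anti.
exists (tilted_mean p b0), b0; split.
- split; first split.
  + exact: tilted_mean_gt0.
  + exact: tilted_mean_lt_p.
  + by rewrite relative_entropy_tilted// gb0 subr0.
  move=> x [x_gt0 x_lt /eqP]; have [b b_gt0 <-] := tilted_mean_surj hp0 hp1 x_gt0 x_lt.
  rewrite relative_entropy_tilted// subr_eq addrC -subr_eq subrr eq_sym => /eqP gb.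
  case: (ltgtP b b0) => [bb0|b0b|->//].
  + by have := entropy_pos b (ltW b_gt0) bb0; rewrite gb ltxx.
  + by have := tilted_entropy_anti hp0 hp1 (ltW b0_gt0) b0b; rewrite gb gb0 ltxx.
- split; first by split.
  by move=> b [_ /esym/(tilted_mean_inj hp0 hp1)].
- apply: filterS bounds => omega [annealed frozen] beta beta_ge0.
  case: (ltgtP beta b0) => [lt_b0|gt_b0|->].
  + exact/annealed/entropy_pos.
  + by apply: frozen => //; exact: ltW.
  have <- : - b0 * tilted_mean p b0 = annealed_free_energy p b0.
    by apply/esym/eqP; rewrite mulNr -addr_eq0; apply/eqP.
  exact: frozen.
Qed.
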